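(* Suppose $\mathbb K\neq\mathbb R$. Let $d$ be a metric on $\mathfrak H_{\mathbb K}$, and denote again by $d$ its extension to $\partial\mathbf{H}^n_{\mathbb K}=\mathfrak H_{\mathbb K}\cup\{\infty\}$. Suppose that all of the following hold: (Sim) $\mathrm{Sim}_{d_{\mathfrak H}}\subseteq\mathrm{Sim}_d$; (Top) every sequence $(p_\nu)_{\nu\in\mathbb N}$ in $\partial\mathbf{H}^n_{\mathbb K}$ which converges in the $d_{\mathfrak H}$-topology of $\partial\mathbf{H}^n_{\mathbb K}$ converges in the $d$-topology of $\partial\mathbf{H}^n_{\mathbb K}$; (Inv) the inversion $I$ belongs to $\mathcal M_d$. Then there exist constants $\beta>0$ and $\alpha\in(0,1]$ such that $d=\beta\cdot d_{\mathfrak H}^{\alpha}$.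
   Context: $\mathbb K$ is one of $\mathbb R,\mathbb C,\mathbb H,\mathbb O$ (reals, complex numbers, quaternions, octonions), with conjugation $z\mapsto\overline z$ (the identity if $\mathbb K=\mathbb R$) and norm $|z|$; $n\ge 2$ is an integer, and $n=2$ if $\mathbb K=\mathbb O$. Put $\Im(\mathbb K)=\{z\in\mathbb K: z=-\overline z\}$, $\operatorname{Im}z=(z-\overline z)/2$, and $\|\zeta\|^2=\sum_i|\zeta_i|^2$ for $\zeta\in\mathbb K^{n-1}$. The $\mathbb K$-Heisenberg group $\mathfrak H_{\mathbb K}$ is the set $\mathbb K^{n-1}\times\Im(\mathbb K)$ with the multiplication $(\zeta,v)*(\zeta',v')=(\zeta+\zeta',\,v+v'+2\omega(\zeta,\zeta'))$, where $\omega(\zeta,\zeta')=\operatorname{Im}\big(\sum_i\overline{\zeta'_i}\zeta_i\big)$; thus $(\zeta,v)^{-1}=(-\zeta,-v)$, and the origin is $o=(0,0)$. The boundary of $\mathbb K$-hyperbolic space is identified with $\partial\mathbf{H}^n_{\mathbb K}=\mathfrak H_{\mathbb K}\cup\{\infty\}$. The Korányi gauge is $|(\zeta,v)|_{\mathbb K}=(\|\zeta\|^4+|v|^2)^{1/4}$ and the Korányi metric is $d_{\mathfrak H}(p,q)=|q^{-1}*p|_{\mathbb K}$ on $\mathfrak H_{\mathbb K}$. Any metric $d$ on $S=\mathfrak H_{\mathbb K}$ (in particular $d_{\mathfrak H}$) is extended to $\overline S=S\cup\{\infty\}$ by $d(p,\infty)=+\infty$ for $p\in S$ and $d(\infty,\infty)=0$.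 The $d$-topology on $\overline S$ is the one extending the metric topology of $S$ for which the sets $\{q\in S:d(o,q)>R\}\cup\{\infty\}$, $R>0$, are basic neighbourhoods of $\infty$. For pairwise distinct $p_1,\dots,p_4\in\overline S$ the metric cross-ratio is $|\mathbb X^d|(p_1,p_2,p_3,p_4)=\frac{d(p_4,p_2)}{d(p_4,p_1)}\cdot\frac{d(p_3,p_1)}{d(p_3,p_2)}$, where, if one of the points is $\infty$, the two factors containing $\infty$ are cancelled. The Möbius group $\mathcal M_d$ is the group of homeomorphisms of $\overline S$ (in the $d$-topology) which leave $|\mathbb X^d|$ invariant on all quadruples of pairwise distinct points. The similarity group $\mathrm{Sim}_d$ is the set of $\phi\in\mathcal M_d$ for which there is a constant $K(\phi)>0$ with $d(\phi(p),\phi(q))=K(\phi)\,d(p,q)$ for all $p,q\in S$. The inversion $I:\partial\mathbf{H}^n_{\mathbb K}\to\partial\mathbf{H}^n_{\mathbb K}$ is given by $I(\zeta,v)=\big(\zeta(-\|\zeta\|^2+v)^{-1},\ \overline v\,|-\|\zeta\|^2+v|^{-2}\big)$ for $(\zeta,v)\neq o$ in $\mathfrak H_{\mathbb K}$ (each coordinate of $\zeta$ multiplied on the right), $I(o)=\infty$, $I(\infty)=o$. *)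

(* Defs.v *)
From HB Require Import structures.
From mathcomp Require Import all_boot all_order all_algebra.
From mathcomp Require Import all_classical all_reals all_analysis.

Set Implicit Arguments.
Unset Strict Implicit.
Unset Printing Implicit Defensive.

Import Order.TTheory GRing.Theory Num.Theory.
Local Open Scope classical_set_scope.
Local Open Scope ring_scope.

Section CayleyDickson.
Context {R : realType}.

(* The k-fold Cayley-Dickson double of R: reals, complex numbers, quaternions
   and octonions for k = 0, 1, 2, 3. Only the R-module structure is recorded
   in the type, so that [*%R] never denotes the componentwise product of
   pairs; the product of the algebra is [cdmul]. *)
Fixpoint cayley_dickson (k : nat) : lmodType R :=
  if k is k'.+1 then (cayley_dickson k' * cayley_dickson k')%type : lmodType R
  else R^o.
Arguments cayley_dickson : simpl never.

Fixpoint cdone (k : nat) : cayley_dickson k :=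
  if k is k'.+1 return cayley_dickson k then (cdone k', 0) else (1 : R).

Fixpoint cdconj (k : nat) : cayley_dickson k -> cayley_dickson k :=
  if k is k'.+1 return cayley_dickson k -> cayley_dickson k
  then fun x => (cdconj x.1, - x.2) else id.

(* (a, b)(c, d) = (a c - d^* b, d a + b c^* ) *)
Fixpoint cdmul (k : nat) :
    cayley_dickson k -> cayley_dickson k -> cayley_dickson k :=
  if k is k'.+1 return cayley_dickson k -> cayley_dickson k -> cayley_dickson k
  then fun x y => (cdmul x.1 y.1 - cdmul (cdconj y.2) x.2,
                   cdmul y.2 x.1 + cdmul x.2 (cdconj y.1))
  else fun x y : R => x * y.

Arguments cdmul : simpl never.

Lemma cdmulS k (x y : cayley_dickson k.+1) :
  cdmul x y = (cdmul x.1 y.1 - cdmul (cdconj y.2) x.2,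
               cdmul y.2 x.1 + cdmul x.2 (cdconj y.1)).
Proof. by []. Qed.

Fixpoint cdnormsq (k : nat) : cayley_dickson k -> R :=
  if k is k'.+1 return cayley_dickson k -> R
  then fun x => cdnormsq x.1 + cdnormsq x.2 else fun x : R => x ^+ 2.

Definition cdnorm (k : nat) (x : cayley_dickson k) : R := Num.sqrt (cdnormsq x).

Definition cdinv (k : nat) (x : cayley_dickson k) : cayley_dickson k :=
  (cdnorm x ^+ 2)^-1 *: cdconj x.

Lemma cdconj_is_linear k : linear (@cdconj k).
Proof.
elim: k => [|k IHk] //= a x y.
by rewrite IHk opprD -scalerN.
Qed.

HB.instance Definition _ k := GRing.isLinear.Build R (cayley_dickson k)
  (cayley_dickson k) _ (@cdconj k) (@cdconj_is_linear k).

Lemma cdconjK k : involutive (@cdconj k).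
Proof. by elim: k => [|k IHk] //= [x y] /=; rewrite IHk opprK. Qed.

Lemma cdmul_linear k : (forall x, linear (@cdmul k x)) /\
  (forall y, linear (fun x => @cdmul k x y)).
Proof.
elim: k => [|k [IHl IHr]].
  split=> [x a y z|y a x z]; rewrite /cdmul.
    by rewrite mulrDr /GRing.scale/= mulrCA.
  by rewrite mulrDl /GRing.scale/= mulrA.
split=> [x a y z|y a x z]; rewrite !cdmulS; congr pair => /=.
- by rewrite linearP IHl IHr opprD addrACA scalerBr.
- by rewrite IHr linearP IHl addrACA scalerDr.
- by rewrite IHr IHl opprD addrACA scalerBr.
- by rewrite IHl IHr addrACA scalerDr.
Qed.

HB.instance Definition _ k x := GRing.isLinear.Build R (cayley_dickson k)
  (cayley_dickson k) _ (@cdmul k x) ((@cdmul_linear k).1 x).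

Lemma cdmulNl k x y : @cdmul k (- x) y = - cdmul x y.
Proof.
have H := (@cdmul_linear k).2 y; have := H (-1) x 0.
have := H (-1) 0 0; rewrite scaler0 addr0 scaleN1r addNr => ->.
by rewrite !scaleN1r !addr0.
Qed.

Lemma cdmulZl k a x y : @cdmul k (a *: x) y = a *: cdmul x y.
Proof.
have H := (@cdmul_linear k).2 y; have := H a x 0.
have := H (-1) 0 0; rewrite scaler0 addr0 scaleN1r addNr => ->.
by rewrite !addr0.
Qed.

Lemma cdmul_conj k x : @cdmul k x (cdconj x) = cdnormsq x *: cdone k /\
  @cdmul k (cdconj x) x = cdnormsq x *: cdone k.
Proof.
elim: k x => [x|k IHk]; first by split; rewrite /GRing.scale/= mulr1.
suff main (a b : cayley_dickson k) : let x : cayley_dickson k.+1 := (a, b) in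
    cdmul x (cdconj x) = cdnormsq x *: cdone k.+1 /\
    cdmul (cdconj x) x = cdnormsq x *: cdone k.+1 by case=> a b; exact: main.
have [[aa' a'a] [_ b'b]] := (IHk a, IHk b).
split; rewrite cdmulS; congr pair => /=.
- by rewrite aa' (linearN (@cdconj k))/= cdmulNl opprK b'b scalerDl.
- by rewrite cdmulNl cdconjK addNr scaler0.
- by rewrite a'a (linearN (@cdmul k _))/= b'b opprK scalerDl.
- by rewrite cdmulNl subrr scaler0.
Qed.

Lemma cdnormsq_ge0 k x : 0 <= @cdnormsq k x.
Proof. by elim: k x => [x|k IHk x] /=; rewrite ?sqr_ge0 ?addr_ge0. Qed.

Lemma cdnormsq_eq0 k x : (@cdnormsq k x == 0) = (x == 0).
Proof.
elim: k x => [x|k IHk [a b]] /=; first by rewrite expf_eq0.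
by rewrite paddr_eq0 ?cdnormsq_ge0// !IHk -pair_eqE.
Qed.

Lemma cdmulV k x : x != 0 ->
  @cdmul k x (cdinv x) = cdone k /\ cdmul (cdinv x) x = cdone k.
Proof.
move=> x0; have nx0 : cdnormsq x != 0 by rewrite cdnormsq_eq0.
have [xx' x'x] := cdmul_conj x.
rewrite /cdinv /cdnorm sqr_sqrtr ?cdnormsq_ge0// linearZ cdmulZl/= xx' x'x.
by rewrite scalerA mulVf// scale1r.
Qed.

End CayleyDickson.
Arguments cayley_dickson : clear implicits, simpl never.
Arguments cdone {R} k.

Inductive division_algebra := Reals | Complexes | Quaternions | Octonions.

Definition doublings (K : division_algebra) : nat :=
  match K with Reals => 0 | Complexes => 1 | Quaternions => 2 | Octonions => 3 end.

Notation algebra R K := (cayley_dickson R (doublings K)).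

Section Imaginary.
Context (R : realType) (K : division_algebra).
Local Notation KK := (algebra R K).

Definition imaginary_pred : pred KK := fun z => z == - cdconj z.

Lemma imaginary_submod_closed : submod_closed imaginary_pred.
Proof.
split=> [|a x y /eqP xE /eqP yE]; apply/eqP.
  by rewrite linear0 oppr0.
by rewrite linearP opprD -scalerN -xE -yE.
Qed.

HB.instance Definition _ :=
  GRing.isSubmodClosed.Build R KK imaginary_pred imaginary_submod_closed.

Record imaginary := Imaginary { imval :> KK ; _ : imaginary_pred imval }.

HB.instance Definition _ := [isSub for imval].
HB.instance Definition _ := [Choice of imaginary by <:].
HB.instance Definition _ := [SubChoice_isSubLmodule of imaginary by <:].

Fact imag_part_subproof (z : KK) : imaginary_pred (2^-1 *: (z - cdconj z)).
Proof.
by rewrite /imaginary_pred linearZ /= (linearB (@cdconj R _)) /=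
  cdconjK -scalerN opprB.
Qed.

Definition imag_part (z : KK) : imaginary := Imaginary (imag_part_subproof z).

Fact imconj_subproof (v : imaginary) : imaginary_pred (cdconj (imval v)).
Proof.
by case: v => z /= /eqP zE; rewrite /imaginary_pred cdconjK -eqr_oppLR -zE.
Qed.

Definition imconj (v : imaginary) : imaginary := Imaginary (imconj_subproof v).

End Imaginary.

Section ExtendedMetric.
Context {R : realType} {S : choiceType}.

Record is_metric (d : S -> S -> R) : Prop := IsMetric {
  metric_xx : forall x, d x x = 0 ;
  metric_positivity : forall x y, d x y = 0 -> x = y ;
  metric_symm : forall x y, d x y = d y x ;
  metric_triang : forall y x z, d x z <= d x y + d y z
}.

(* In [option S], [None] is the point at infinity. *)
Definition ext_dist (d : S -> S -> R) (p q : option S) : \bar R :=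
  match p, q with
  | Some x, Some y => (d x y)%:E
  | None, None => 0%E
  | _, _ => +oo%E
  end.

(* [option S] with the d-topology; [o] is the base point from which the
   neighbourhoods of infinity are measured. *)
Definition extension (o : S) (d : S -> S -> R) : Type := option S.

Definition ext_open (o : S) (d : S -> S -> R) : set_system (option S) :=
  [set U | (forall p, U (Some p) ->
             exists2 e : R, 0 < e & forall q, d p q < e -> U (Some q)) /\
           (U None ->
             exists2 r : R, 0 < r & forall q, r < d o q -> U (Some q))].

Fact ext_openT o d : ext_open o d setT.
Proof. by split=> *; exists 1. Qed.

Fact ext_openI o d : setI_closed (ext_open o d).
Proof.
move=> U V [US UN] [VS VN]; split=> [p [/US[e e0 eU] /VS[f f0 fV]]|
    [/UN[e e0 eU] /VN[f f0 fV]]].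
  exists (Num.min e f); first by rewrite lt_min e0.
  by move=> q; rewrite lt_min => /andP[/eU ? /fV].
exists (Num.max e f); first by rewrite lt_max e0.
by move=> q; rewrite gt_max => /andP[/eU ? /fV].
Qed.

Fact ext_open_bigU o d (I : Type) (f : I -> set (option S)) :
  (forall i, ext_open o d (f i)) -> ext_open o d (\bigcup_i f i).
Proof.
move=> fo; split=> [p [i _ /(fo i).1[e e0 ef]]|[i _ /(fo i).2[e e0 ef]]];
  by exists e => // q /ef; exists i.
Qed.

HB.instance Definition _ o d := Choice.copy (extension o d) (option S).
HB.instance Definition _ o d := isOpenTopological.Build (extension o d)
  (ext_openT o d) (@ext_openI o d) (@ext_open_bigU o d).

(* The value 1 at infinity cancels the factors containing infinity. *)
Definition cross_factor (d : S -> S -> R) (p q : option S) : R :=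
  if (p, q) is (Some x, Some y) then d x y else 1.

Definition cross_ratio (d : S -> S -> R) (p1 p2 p3 p4 : option S) : R :=
  cross_factor d p4 p2 / cross_factor d p4 p1 *
  (cross_factor d p3 p1 / cross_factor d p3 p2).

Definition homeomorphism (T U : topologicalType) (f : T -> U) : Prop :=
  continuous f /\ exists g : U -> T, [/\ cancel f g, cancel g f & continuous g].

Definition mobius (o : S) (d : S -> S -> R) : set (option S -> option S) :=
  [set f | homeomorphism (f : extension o d -> extension o d) /\
    forall p1 p2 p3 p4 : option S, uniq [:: p1; p2; p3; p4] ->
      cross_ratio d (f p1) (f p2) (f p3) (f p4) = cross_ratio d p1 p2 p3 p4].

Definition similarity (o : S) (d : S -> S -> R) : set (option S -> option S) :=
  [set f | mobius o d f /\ exists2 k : R, 0 < k & forall p q : S,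
    ext_dist d (f (Some p)) (f (Some q)) = (k%:E * ext_dist d (Some p) (Some q))%E].

Definition converges (o : S) (d : S -> S -> R) (p : nat -> option S) : Prop :=
  exists l : extension o d, (p : nat -> extension o d) @ \oo --> l.

End ExtendedMetric.

Section Heisenberg.
Context {R : realType} {K : division_algebra} {n : nat}.
Local Notation KK := (algebra R K).

Definition heisenberg : Type := ('rV[KK]_n.-1 * imaginary R K)%type.

HB.instance Definition _ := Choice.on heisenberg.

Definition horigin : heisenberg := (0, 0).

Definition vnormsq (z : 'rV[KK]_n.-1) : R := \sum_i cdnorm (z 0 i) ^+ 2.

Definition omega (z z' : 'rV[KK]_n.-1) : imaginary R K :=
  imag_part (\sum_i cdmul (cdconj (z' 0 i)) (z 0 i)).

Definition hmul (p q : heisenberg) : heisenberg :=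
  (p.1 + q.1, p.2 + q.2 + 2 *: omega p.1 q.1).

Definition hinv (p : heisenberg) : heisenberg := (- p.1, - p.2).

Definition koranyi_gauge (p : heisenberg) : R :=
  (vnormsq p.1 ^+ 2 + cdnorm (imval p.2) ^+ 2) `^ 4^-1.

Definition koranyi_dist (p q : heisenberg) : R := koranyi_gauge (hmul (hinv q) p).

(* - ||zeta||^2 + v, the element of K inverted in the inversion *)
Definition siegel (p : heisenberg) : KK :=
  - vnormsq p.1 *: cdone (doublings K) + imval p.2.

Definition inversion (p : option heisenberg) : option heisenberg :=
  if p is Some x then
    if x == horigin then None
    else Some (\row_i cdmul (x.1 0 i) (cdinv (siegel x)),
               (cdnorm (siegel x) ^+ 2)^-1 *: imconj x.2)
  else Some horigin.

End Heisenberg.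
Arguments heisenberg : clear implicits.

(* Main.v *)
(* Conjugating a translation by the dilation of ratio 2 turns it into one of its
   powers, so translations scale [d] by the factor 1, and [d] is determined by
   [g p = d o p]. The scaling factor of the dilation of ratio [r] is
   multiplicative in [r] and, by (Top), less than 1 for [r < 1]; hence it is
   [r `^ alpha] with [alpha > 0], and [alpha <= 1] by the triangle inequality.

   The cross-ratio identities at 0 and infinity read [g p * g (I p) = c] and
   [d (I p) (I q) = c * d p q / (g p * g q)]. On points with [zeta = 0] or
   [v = 0], [I p] is the inverse of [p] up to dilation, so the first identity
   gives [g p] there. In general, normalise [|zeta| = 1]. Up to dilation,
   [I (zeta, v)] is the inverse of [(zeta u, v)] with [u = (1 + v) / |1 + v|],
   so it remains to see that [g (zeta u, v) = g (zeta, v)]. Write [(zeta, v)] as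
   [q^-1 * p] with [p = (zeta (x - v / 2), 0)], [q = (zeta (x - 1 - v / 2), 0)]:
   for the negative solution [x] of [x ^+ 2 = 1 / 2 + |v| ^+ 2 / 4],
   [(I q)^-1 * I p] is [(zeta u, v)] up to dilation, and the second identity
   concludes. Only the real span of 1 and [v] acts on [zeta], which is why no
   associativity of the octonions is needed. *)

From HB Require Import structures.
Require Import Defs.
From mathcomp Require Import all_boot all_order all_algebra.
From mathcomp Require Import all_classical all_reals all_analysis.
From mathcomp Require Import ring lra zify.
Import Order.TTheory GRing.Theory Num.Theory.
Local Open Scope classical_set_scope.
Local Open Scope ring_scope.

Lemma cdconj1 (R : realType) k :
  cdconj (cdone k) = cdone k :> cayley_dickson R k.
Proof. by elim: k => [|k IHk] //=; rewrite IHk oppr0. Qed.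

Lemma cdmul0x (R : realType) k (x : cayley_dickson R k) : cdmul 0 x = 0.
Proof. by rewrite -[X in cdmul X x](scale0r x) cdmulZl scale0r. Qed.

Lemma cdmulx1 (R : realType) k (x : cayley_dickson R k) :
  cdmul x (cdone k) = x.
Proof.
elim: k x => [|k IHk] x; first by rewrite /cdmul/= mulr1.
case: x => x1 x2.
by rewrite cdmulS/= linear0 !cdmul0x subr0 add0r cdconj1 !IHk.
Qed.

Lemma cdnormsq0 (R : realType) k : cdnormsq (0 : cayley_dickson R k) = 0.
Proof. by apply/eqP; rewrite cdnormsq_eq0. Qed.

Lemma cdnormsq1 (R : realType) k : cdnormsq (cdone k : cayley_dickson R k) = 1.
Proof.
by elim: k => [|k IHk] /=; [rewrite expr1n|rewrite IHk cdnormsq0 addr0].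
Qed.

Section CayleyDicksonNorm.
Context {R : realType} {k : nat}.
Local Notation A := (cayley_dickson R k).
Implicit Types (a : R) (x y z : A).

Lemma cdnormsqZ a x : cdnormsq (a *: x) = a ^+ 2 * cdnormsq x.
Proof.
elim: k x => [x|j IHj x] /=; first by rewrite /GRing.scale/= exprMn.
by rewrite !IHj mulrDr.
Qed.

Lemma cdnormsqN x : cdnormsq (- x) = cdnormsq x.
Proof. by rewrite -scaleN1r cdnormsqZ sqrrN expr1n mul1r. Qed.

Lemma cdnormsqD_le x y : cdnormsq (x + y) <= 2 * cdnormsq x + 2 * cdnormsq y.
Proof.
elim: k x y => [x y|j IHj x y] /=.
  suff main (u w : R) : (u + w) ^+ 2 <= 2 * u ^+ 2 + 2 * w ^+ 2 by exact: main.
  by have := sqr_ge0 (u - w); nra.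
by apply: le_trans (lerD (IHj _ _) (IHj _ _)) _; lra.
Qed.

Lemma cdnormsq_sum_le (I : Type) (r : seq I) (F : I -> A) (M : R) :
  0 <= M -> (forall i, cdnormsq (F i) <= M) ->
  cdnormsq (\sum_(i <- r) F i) <= 4 ^+ size r * M.
Proof.
move=> M0 FM; elim: r => [|i r IHr] /=.
  by rewrite big_nil cdnormsq0 expr0 mul1r.
rewrite big_cons (le_trans (cdnormsqD_le _ _))//.
have pow1 : 1 <= 4 ^+ size r :> R by rewrite exprn_ege1// ler1n.
have := ler_wpM2r M0 pow1; have := FM i.
by rewrite exprS mul1r -mulrA; lra.
Qed.

Lemma cdnorm_sqr x : cdnorm x ^+ 2 = cdnormsq x.
Proof. by rewrite sqr_sqrtr// cdnormsq_ge0. Qed.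

Lemma cdnormsqDim a x : x = - cdconj x ->
  cdnormsq (a *: cdone k + x) = a ^+ 2 + cdnormsq x.
Proof.
elim: k x => [x xE|j IHj [x1 x2] [x1E]].
  have -> : x = 0 by move: xE => /= xE; lra.
  by rewrite /= addr0 /GRing.scale/= mulr1 expr0n addr0.
by rewrite /= scaler0 add0r (IHj _ x1E) addrA.
Qed.

Lemma cdmulDl x y z : cdmul (x + y) z = cdmul x z + cdmul y z.
Proof. by have := (cdmul_linear k).2 z 1 x y; rewrite !scale1r. Qed.

End CayleyDicksonNorm.

Section DivisionAlgebra.
Context {R : realType} {K : division_algebra}.
Local Notation KK := (algebra R K).
Implicit Types (x y z : KK) (u v : imaginary R K).

Lemma cdnormsqM x y : cdnormsq (cdmul x y) = cdnormsq x * cdnormsq y.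
Proof.
case: K x y => [x y|||] /=; first by rewrite /cdmul /= exprMn.
- by move=> [x1 x2] [y1 y2]; rewrite /cdmul/=; ring.
- by move=> [[x1 x2] [x3 x4]] [[y1 y2] [y3 y4]]; rewrite /cdmul/=; ring.
- move=> [[[x1 x2] [x3 x4]] [[x5 x6] [x7 x8]]].
  move=> [[[y1 y2] [y3 y4]] [[y5 y6] [y7 y8]]].
  by rewrite /cdmul/=; ring.
Qed.

Lemma cdconjMK x y : cdmul (cdconj (cdmul x y)) x = cdnormsq x *: cdconj y.
Proof.
case: K x y => [x y|||] /=; first by rewrite /cdmul /GRing.scale/=; ring.
- move=> [x1 x2] [y1 y2].
  by rewrite /cdmul/=; congr (_, _); rewrite /GRing.scale/=; ring.
- move=> [[x1 x2] [x3 x4]] [[y1 y2] [y3 y4]].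
  by rewrite /cdmul/=; congr ((_, _), (_, _)); rewrite /GRing.scale/=; ring.
- move=> [[[x1 x2] [x3 x4]] [[x5 x6] [x7 x8]]].
  move=> [[[y1 y2] [y3 y4]] [[y5 y6] [y7 y8]]].
  rewrite /cdmul/=; congr ((_, _, (_, _)), (_, _, (_, _)));
    by rewrite /GRing.scale/=; ring.
Qed.

Lemma imaginaryE u : imval u = - cdconj (imval u).
Proof. by case: u => u /= /eqP. Qed.

Lemma imconjE u : imconj u = - u.
Proof.
by apply: val_inj; rewrite /= [in RHS]imaginaryE opprK.
Qed.

Lemma imag_partP : linear (@imag_part R K).
Proof.
move=> a x y; apply: val_inj => /=; rewrite linearP/=.
by rewrite scalerA mulrC -scalerA -scalerDr opprD addrACA -scalerBr.
Qed.

HB.instance Definition _ := GRing.isLinear.Build R KK (imaginary R K) _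
  (@imag_part R K) imag_partP.

Lemma imag_part_real (a : R) : imag_part (a *: cdone (doublings K)) = 0.
Proof.
by apply: val_inj; rewrite /= linearZ/= cdconj1 subrr scaler0.
Qed.

Lemma imag_part_im u : imag_part (imval u) = u.
Proof.
apply: val_inj; rewrite /= -imaginaryE -mulr2n -(scaler_nat 2 (imval u)).
by rewrite scalerA mulVf ?scale1r ?pnatr_eq0.
Qed.

End DivisionAlgebra.

Section HeisenbergGroup.
Context {R : realType} {K : division_algebra} {n : nat}.
Local Notation KK := (algebra R K).
Local Notation H := (heisenberg R K n).
Implicit Types (r s : R) (x y z : 'rV[KK]_n.-1) (u v : imaginary R K).
Implicit Types p q a : H.

Lemma vnormsqE z : vnormsq z = \sum_i cdnormsq (z 0 i).
Proof. by apply: eq_bigr => i _; rewrite cdnorm_sqr. Qed.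

Lemma vnormsq_ge0 z : 0 <= vnormsq z.
Proof. by rewrite vnormsqE sumr_ge0// => i _; rewrite cdnormsq_ge0. Qed.

Lemma vnormsq_eq0 z : (vnormsq z == 0) = (z == 0).
Proof.
rewrite vnormsqE psumr_eq0; last by move=> i _; rewrite cdnormsq_ge0.
apply/allP/eqP => [z0|-> i _]; last by rewrite mxE cdnormsq0 eqxx.
apply/rowP => i; rewrite mxE; apply/eqP.
by rewrite -cdnormsq_eq0; exact: (z0 i (mem_index_enum i)).
Qed.

(* ['rV[KK]_n.-1] carries no [R]-module structure, [KK] being only a module. *)
Definition rscale r z : 'rV[KK]_n.-1 := \row_i (r *: z 0 i).

Lemma rscaleA r s z : rscale r (rscale s z) = rscale (r * s) z.
Proof. by apply/rowP => i; rewrite !mxE scalerA. Qed.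

Lemma rscaleDr r x z : rscale r (x + z) = rscale r x + rscale r z.
Proof. by apply/rowP => i; rewrite !mxE scalerDr. Qed.

Lemma rscale1 z : rscale 1 z = z.
Proof. by apply/rowP => i; rewrite !mxE scale1r. Qed.

Lemma rscaleN1 z : rscale (- 1) z = - z.
Proof. by apply/rowP => i; rewrite !mxE scaleN1r. Qed.

Lemma rscale0 z : rscale 0 z = 0.
Proof. by apply/rowP => i; rewrite !mxE scale0r. Qed.

Lemma rscaler0 r : rscale r 0 = 0.
Proof. by apply/rowP => i; rewrite !mxE scaler0. Qed.

Lemma vnormsqZ r z : vnormsq (rscale r z) = r ^+ 2 * vnormsq z.
Proof.
rewrite !vnormsqE mulr_sumr; apply: eq_bigr => i _.
by rewrite mxE cdnormsqZ.
Qed.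

Lemma vnormsqN z : vnormsq (- z) = vnormsq z.
Proof. by rewrite -rscaleN1 vnormsqZ sqrrN expr1n mul1r. Qed.

Lemma vnormsqD_le x y : vnormsq (x + y) <= 2 * vnormsq x + 2 * vnormsq y.
Proof.
rewrite !vnormsqE !mulr_sumr -big_split/=; apply: ler_sum => i _.
by rewrite mxE cdnormsqD_le.
Qed.

Lemma omegaDl x y z : omega (x + y) z = omega x z + omega y z.
Proof.
rewrite /omega -linearD/= -big_split/=; congr imag_part.
by apply: eq_bigr => i _; rewrite mxE linearD.
Qed.

Lemma omegaZl r x z : omega (rscale r x) z = r *: omega x z.
Proof.
rewrite /omega -linearZ/= scaler_sumr; congr imag_part.
by apply: eq_bigr => i _; rewrite mxE linearZ.
Qed.

Lemma omegaDr x y z : omega z (x + y) = omega z x + omega z y.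
Proof.
rewrite /omega -linearD/= -big_split/=; congr imag_part.
by apply: eq_bigr => i _; rewrite mxE linearD/= cdmulDl.
Qed.

Lemma omegaZr r x z : omega z (rscale r x) = r *: omega z x.
Proof.
rewrite /omega -linearZ/= scaler_sumr; congr imag_part.
by apply: eq_bigr => i _; rewrite mxE linearZ/= cdmulZl.
Qed.

Lemma omegaxx x : omega x x = 0.
Proof.
rewrite /omega (eq_bigr (fun i => cdnormsq (x 0 i) *: cdone (doublings K))).
  by rewrite -scaler_suml imag_part_real.
by move=> i _; rewrite (cdmul_conj _).2.
Qed.

Lemma omegaC x y : omega x y = - omega y x.
Proof.
have := omegaxx (x + y); rewrite omegaDl !omegaDr !omegaxx add0r addr0.
by move/eqP; rewrite addr_eq0 => /eqP.
Qed.

Lemma omegaNl x y : omega (- x) y = - omega x y.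
Proof. by rewrite -rscaleN1 omegaZl scaleN1r. Qed.

Lemma omegaNr x y : omega x (- y) = - omega x y.
Proof. by rewrite -rscaleN1 omegaZr scaleN1r. Qed.

Lemma omega0l x : omega 0 x = 0.
Proof. by rewrite -(rscale0 0) omegaZl scale0r. Qed.

Lemma omega0r x : omega x 0 = 0.
Proof. by rewrite -(rscale0 0) omegaZr scale0r. Qed.

Definition rmulv z v : 'rV[KK]_n.-1 := \row_i cdmul (z 0 i) (imval v).

Lemma omega_rmulv z v : omega z (rmulv z v) = - (vnormsq z *: v).
Proof.
rewrite /omega (eq_bigr (fun i => cdnormsq (z 0 i) *: cdconj (imval v))).
  rewrite -scaler_suml -vnormsqE -[cdconj _]opprK -imaginaryE linearZ/=.
  by rewrite linearN/= imag_part_im scalerN.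
by move=> i _; rewrite mxE cdconjMK.
Qed.

Lemma vnormsq_rmulv r s z v :
  vnormsq (rscale r z + rscale s (rmulv z v)) =
  vnormsq z * (r ^+ 2 + s ^+ 2 * cdnormsq (imval v)).
Proof.
rewrite !vnormsqE mulr_suml; apply: eq_bigr => i _; rewrite !mxE.
rewrite -[X in r *: X]cdmulx1 -!linearZ/= -linearD/= cdnormsqM -cdnormsqZ.
by rewrite cdnormsqDim//; exact: (imaginaryE (s *: v)).
Qed.

Definition dilation r p : H := (rscale r p.1, r ^+ 2 *: p.2).

Lemma hmul0p p : hmul horigin p = p.
Proof. by case: p => z v; rewrite /hmul/= omega0l scaler0 !add0r addr0. Qed.

Lemma hmulp0 p : hmul p horigin = p.
Proof. by case: p => z v; rewrite /hmul/= omega0r scaler0 !addr0. Qed.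

Lemma hmulVp p : hmul (hinv p) p = horigin.
Proof.
case: p => z v; rewrite /hmul/= omegaNl omegaxx oppr0 scaler0 !addNr addr0.
by [].
Qed.

Lemma hmulA p q a : hmul p (hmul q a) = hmul (hmul p q) a.
Proof.
rewrite /hmul/= addrA; congr pair.
rewrite omegaDl omegaDr !scalerDr !addrA.
by rewrite [LHS](ACl (1 * 2 * 5 * 3 * 6 * 4)%AC).
Qed.

Lemma hinvK p : hinv (hinv p) = p.
Proof. by case: p => z v; rewrite /hinv/= !opprK. Qed.

Lemma hmulpV p : hmul p (hinv p) = horigin.
Proof. by rewrite -[X in hmul X _]hinvK hmulVp. Qed.

Lemma hinvM p q : hinv (hmul p q) = hmul (hinv q) (hinv p).
Proof.
rewrite /hinv/hmul/= omegaNl omegaNr opprK [in RHS]omegaC scalerN.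
by rewrite !opprD [- p.1 - _]addrC [- p.2 - _]addrC.
Qed.

Lemma dilationM r p q :
  dilation r (hmul p q) = hmul (dilation r p) (dilation r q).
Proof.
rewrite /dilation/hmul/= rscaleDr; congr pair.
by rewrite omegaZl omegaZr !scalerDr !scalerA -expr2 mulrC.
Qed.

Lemma dilation_dilation r s p : dilation r (dilation s p) = dilation (r * s) p.
Proof. by rewrite /dilation/= rscaleA scalerA exprMn. Qed.

Lemma dilation1 p : dilation 1 p = p.
Proof. by case: p => z v; rewrite /dilation/= expr1n rscale1 scale1r. Qed.

Lemma neq_origin1 p : p.1 != 0 -> p <> horigin.
Proof. by move=> p0 pE; move: p0; rewrite pE eqxx. Qed.

Lemma neq_origin2 p : p.2 != 0 -> p <> horigin.
Proof. by move=> p0 pE; move: p0; rewrite pE eqxx. Qed.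

Lemma dilation0 r : dilation r horigin = horigin :> H.
Proof. by rewrite /dilation/= rscaler0 scaler0. Qed.

End HeisenbergGroup.

Section Scaling.
Context {R : realType} {S : choiceType}.
Implicit Types (o : S) (d : S -> S -> R) (f g : S -> S) (k : R).

Definition scales d k f := forall p q, d (f p) (f q) = k * d p q.

Definition proper o d f :=
  forall M, exists r, forall q, d o (f q) <= M -> d o q <= r.

Lemma scales_continuous o d k f : 0 < k -> scales d k f -> proper o d f ->
  continuous (omap f : extension o d -> extension o d).
Proof.
move=> k0 fk fo; apply/continuousP => U [US UN]; split=> [p /US[e e0 eU]|/UN].
  exists (e / k); first exact: divr_gt0.
  by move=> q; rewrite ltr_pdivlMr// mulrC -fk => /eU.
move=> [r r0 rU]; have [s sP] := fo r.
exists (Num.max s 1); first by rewrite lt_max ltr01 orbT.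
move=> q; rewrite gt_max => /andP[sq _]; apply: rU.
by rewrite ltNge; apply: contraL sq => /sP; rewrite -leNgt.
Qed.

Lemma scales_cross_ratio d k f p1 p2 p3 p4 : 0 < k -> scales d k f ->
  uniq [:: p1; p2; p3; p4] ->
  cross_ratio d (omap f p1) (omap f p2) (omap f p3) (omap f p4) =
  cross_ratio d p1 p2 p3 p4.
Proof.
move=> k0 fk; have kk : k / k = 1 by rewrite divff// gt_eqF.
have E (a b : R) : (k * a) / (k * b) = a / b.
  by rewrite invfM mulrACA kk mul1r.
case: p1 p2 p3 p4 => [p1|] [p2|] [p3|] [p4|] //=;
  rewrite ?inE ?eqxx ?orbT ?andbF// => _; rewrite /cross_ratio /cross_factor;
  rewrite ?div1r ?divr1 ?mul1r ?invr1 ?mul1r ?mulr1 ?fk ?E//.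
by rewrite ![_^-1 * _]mulrC E.
Qed.

Lemma similarity_omap o d k f g : 0 < k -> scales d k f -> proper o d f ->
  cancel f g -> cancel g f -> proper o d g -> similarity o d (omap f).
Proof.
move=> k0 fk fo fgK gfK go.
have gk : scales d k^-1 g.
  by move=> p q; rewrite -[in RHS](gfK p) -[in RHS](gfK q) fk mulKf ?gt_eqF.
split; last by exists k => // p q /=; rewrite fk.
split; last by move=> ? ? ? ?; exact: scales_cross_ratio k0 fk.
split; first exact: scales_continuous fk fo.
exists (omap g); split.
- by case=> //= p; rewrite fgK.
- by case=> //= p; rewrite gfK.
- by apply: scales_continuous gk go; rewrite invr_gt0.
Qed.

Lemma similarity_scales o d f : similarity o d (omap f) ->
  exists2 k, 0 < k & scales d k f.
Proof.
by case=> _ [k k0 fk]; exists k => // p q; apply: EFin_inj; rewrite EFinM -fk.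
Qed.

End Scaling.

Section KoranyiSimilarities.
Context {R : realType} {K : division_algebra} {n : nat}.
Local Notation KK := (algebra R K).
Local Notation H := (heisenberg R K n).
Implicit Types (r : R) (p q a b : H).

Lemma cdnormsq_conj k (x : cayley_dickson R k) :
  cdnormsq (cdconj x) = cdnormsq x.
Proof. by elim: k x => [|k IHk] //= x; rewrite IHk cdnormsqN. Qed.

Definition gauge4 p : R := vnormsq p.1 ^+ 2 + cdnormsq (imval p.2).

Lemma gauge4_ge0 p : 0 <= gauge4 p.
Proof. by rewrite addr_ge0 ?sqr_ge0 ?cdnormsq_ge0. Qed.

Lemma koranyi_gaugeE p : koranyi_gauge p = gauge4 p `^ 4^-1.
Proof. by rewrite /koranyi_gauge cdnorm_sqr. Qed.

Lemma koranyi_gauge_ge0 p : 0 <= koranyi_gauge p.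
Proof. exact: powR_ge0. Qed.

Lemma powR4K r : 0 <= r -> (r ^+ 4) `^ 4^-1 = r.
Proof.
by move=> r0; rewrite -powR_mulrn// -powRrM mulfV ?powRr1 ?pnatr_eq0.
Qed.

Lemma koranyi_gaugeX4 p : koranyi_gauge p ^+ 4 = gauge4 p.
Proof.
rewrite koranyi_gaugeE -powR_mulrn ?powR_ge0// -powRrM mulVf ?pnatr_eq0//.
by rewrite powRr1 ?gauge4_ge0.
Qed.

Lemma koranyi_gauge_dilation r p : 0 <= r ->
  koranyi_gauge (dilation r p) = r * koranyi_gauge p.
Proof.
move=> r0; rewrite !koranyi_gaugeE /gauge4/= vnormsqZ cdnormsqZ.
rewrite -exprM exprMn -exprM -mulrDr powRM ?powR4K ?gauge4_ge0//.
exact: exprn_ge0.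
Qed.

Lemma koranyi_gaugeV p : koranyi_gauge (hinv p) = koranyi_gauge p.
Proof. by rewrite !koranyi_gaugeE /gauge4/= vnormsqN cdnormsqN. Qed.

Lemma koranyi_dist0p p : koranyi_dist horigin p = koranyi_gauge p.
Proof. by rewrite /koranyi_dist hmulp0 koranyi_gaugeV. Qed.

Lemma koranyi_distM a p q :
  koranyi_dist (hmul a p) (hmul a q) = koranyi_dist p q.
Proof.
by rewrite /koranyi_dist hinvM -hmulA (hmulA (hinv a)) hmulVp hmul0p.
Qed.

Lemma dilationV r p : dilation r (hinv p) = hinv (dilation r p).
Proof.
rewrite /dilation/hinv/= scalerN -!rscaleN1 !rscaleA.
by rewrite [r * _]mulrC.
Qed.

Lemma koranyi_dist_dilation r p q : 0 <= r ->
  koranyi_dist (dilation r p) (dilation r q) = r * koranyi_dist p q.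
Proof.
move=> r0.
by rewrite /koranyi_dist -dilationV -dilationM koranyi_gauge_dilation.
Qed.

Lemma omega_bound a (M : R) : 0 <= M -> exists W, forall p,
  vnormsq p.1 <= M -> cdnormsq (imval (omega a.1 p.1)) <= W.
Proof.
move=> M0; exists (4 ^+ size (index_enum 'I_n.-1) * (M * vnormsq a.1)) => p pM.
rewrite /omega/=; set z := \sum_i _.
have zle : cdnormsq z <= 4 ^+ size (index_enum 'I_n.-1) * (M * vnormsq a.1).
  apply: cdnormsq_sum_le => [|i]; first by rewrite mulr_ge0 ?vnormsq_ge0.
  have coord (x : 'rV[KK]_n.-1) : cdnormsq (x 0 i) <= vnormsq x.
    rewrite vnormsqE (bigD1 i)//= lerDl sumr_ge0// => j _.
    exact: cdnormsq_ge0.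
  rewrite cdnormsqM cdnormsq_conj ler_pM ?cdnormsq_ge0//.
  exact: le_trans pM.
apply: le_trans zle.
have := cdnormsqD_le z (- cdconj z).
by rewrite cdnormsqZ cdnormsqN cdnormsq_conj; lra.
Qed.

Lemma translation_proper a : proper horigin (@koranyi_dist R K n) (hmul a).
Proof.
suff main b (M : R) : 0 <= M -> exists r, forall p,
    koranyi_gauge p <= M -> koranyi_gauge (hmul b p) <= r.
  move=> M; have [|r rP] := main (hinv a) (Num.max M 0).
    by rewrite le_max lexx orbT.
  exists r => q; rewrite !koranyi_dist0p => qM.
  rewrite -[q]hmul0p -(hmulVp a) -hmulA; apply: rP.
  by rewrite le_max qM.
move=> M0; have M40 : 0 <= M ^+ 4 by rewrite exprn_ge0.
have [|W WP] := omega_bound b (M ^+ 4 + 1); first exact: addr_ge0.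
pose V := 2 * vnormsq b.1 + 2 * (M ^+ 4 + 1).
pose C := V ^+ 2 + (4 * cdnormsq (imval b.2) + 4 * M ^+ 4 + 8 * W).
exists (C `^ 4^-1) => p pM.
have pM4 : gauge4 p <= M ^+ 4.
  by rewrite -koranyi_gaugeX4 lerXn2r ?nnegrE ?koranyi_gauge_ge0.
have p1 := vnormsq_ge0 p.1; have p2 := cdnormsq_ge0 (imval p.2).
have p1M : vnormsq p.1 <= M ^+ 4 + 1 by move: pM4; rewrite /gauge4; nra.
have p2M : cdnormsq (imval p.2) <= M ^+ 4 by move: pM4; rewrite /gauge4; nra.
have bpC : gauge4 (hmul b p) <= C.
  rewrite /gauge4/=; apply: lerD.
    rewrite lerXn2r ?nnegrE ?vnormsq_ge0//.
      by rewrite addr_ge0 ?mulr_ge0 ?vnormsq_ge0 ?addr_ge0.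
    by apply: le_trans (vnormsqD_le _ _) _; rewrite lerD2l ler_pM2l.
  have := cdnormsqD_le (imval b.2 + imval p.2) (2 *: imval (omega b.1 p.1)).
  rewrite cdnormsqZ; have := cdnormsqD_le (imval b.2) (imval p.2).
  by have := WP p p1M; rewrite /=; lra.
by rewrite koranyi_gaugeE ge0_ler_powR ?nnegrE ?invr_ge0 ?gauge4_ge0//
  (le_trans (gauge4_ge0 _) bpC).
Qed.

Lemma dilation_proper r : 0 < r ->
  proper horigin (@koranyi_dist R K n) (dilation r).
Proof.
move=> r0 M; exists (M / r) => q.
rewrite !koranyi_dist0p koranyi_gauge_dilation ?(ltW r0)// ler_pdivlMr//.
by rewrite mulrC.
Qed.

Lemma translation_similarity a :
  similarity horigin (@koranyi_dist R K n) (omap (hmul a)).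
Proof.
apply: (@similarity_omap _ _ _ _ 1 _ (hmul (hinv a))) => //.
- by move=> p q; rewrite koranyi_distM mul1r.
- exact: translation_proper.
- by move=> p; rewrite hmulA hmulVp hmul0p.
- by move=> p; rewrite hmulA hmulpV hmul0p.
- exact: translation_proper.
Qed.

Lemma dilation_similarity r : 0 < r ->
  similarity horigin (@koranyi_dist R K n) (omap (dilation r)).
Proof.
move=> r0; have rr : r / r = 1 by rewrite divff ?gt_eqF.
apply: (@similarity_omap _ _ _ _ r _ (dilation r^-1)) => //.
- by move=> p q; rewrite koranyi_dist_dilation ?ltW.
- exact: dilation_proper.
- by move=> p; rewrite dilation_dilation mulrC rr dilation1.
- by move=> p; rewrite dilation_dilation rr dilation1.
- by apply: dilation_proper; rewrite invr_gt0.
Qed.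

End KoranyiSimilarities.

Section Convergence.
Context {R : realType} {S : choiceType}.
Implicit Types (o x : S) (d : S -> S -> R) (s : nat -> S).

Definition tends_to d s x :=
  forall e : R, 0 < e -> exists N, forall m, (N <= m)%N -> d x (s m) < e.

Lemma metric_ge0 d : is_metric d -> forall x y, 0 <= d x y.
Proof.
move=> dm x y; have := metric_triang dm y x x.
by rewrite (metric_xx dm) (metric_symm dm y); lra.
Qed.

Lemma metric_gt0 d x y : is_metric d -> x <> y -> 0 < d x y.
Proof.
move=> dm xy; rewrite lt_def metric_ge0// andbT.
by apply: contra_not_neq xy => /(metric_positivity dm).
Qed.

Lemma ext_openC1 o d x : is_metric d -> ext_open o d (~` [set Some x]).
Proof.
move=> dm; split=> [p px|_].
  exists (d p x); last by move=> q /[swap] -[->]; rewrite ltxx.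
  by apply: metric_gt0 => // px'; apply: px; rewrite px'.
exists (Num.max 1 (d o x)); first by rewrite lt_max ltr01.
by move=> q /[swap] -[->]; rewrite gt_max ltxx andbF.
Qed.

Lemma ext_open_ball o d x e : is_metric d ->
  ext_open o d [set p | if p is Some q then d x q < e else False].
Proof.
move=> dm; split=> // p /= pe; exists (e - d x p); first by rewrite subr_gt0.
by move=> q; have := metric_triang dm p x q; lra.
Qed.

Lemma tends_to_transfer o d d' x s : is_metric d' ->
  (forall p : nat -> option S, converges o d p -> converges o d' p) ->
  d x x = 0 -> tends_to d s x -> tends_to d' s x.
Proof.
move=> d'm top dxx sx.
(* Interleaving with the constant [x] identifies the limit given by [top]. *)
pose t m := if odd m then Some x else Some (s m./2).
have [|l tl] := top t.
  exists (Some x : extension o d) => U; rewrite nbhsE => -[V [[Vo _] Vx] VU].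
  have [e e0 eV] := Vo x Vx; have [N Ns] := sx e e0.
  exists N.*2 => // m /= Nm; apply: VU; rewrite /t.
  case: ifP => // _; apply/eV/Ns; lia.
have evt (U : set (option S)) : ext_open o d' U -> U l ->
    exists N, forall m, (N <= m)%N -> U (t m).
  move=> Uo Ul; have [|N _ NU] := tl U.
    by apply: (@open_nbhs_nbhs (extension o d')); split.
  by exists N => m /NU.
have lx : l = Some x.
  apply: contrapT => lx.
  have [N /(_ N.*2.+1)] := evt _ (ext_openC1 o d' x d'm) lx.
  rewrite /t /= odd_double /= => NU; apply: NU => //; lia.
move=> e e0; have [|N NU] := evt _ (ext_open_ball o d' x e d'm).
  by rewrite lx /= (metric_xx d'm).
exists N => m Nm; have := NU m.*2; rewrite /t odd_double doubleK; apply; lia.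
Qed.

End Convergence.

Section GeometricDecay.
Import numFieldNormedType.Exports.

Lemma expr_lt_eventually {R : realType} (r e : R) : 0 < r < 1 -> 0 < e ->
  exists N, forall m, (N <= m)%N -> r ^+ m < e.
Proof.
move=> /andP[r0 r1] e0.
have /cvgrPdist_lt/(_ e e0)[N _ NP] : r ^+ m @[m --> \oo] --> (0 : R).
  by apply: cvg_expr; rewrite gtr0_norm.
exists N => m /NP /=; rewrite sub0r normrN gtr0_norm//.
exact: exprn_gt0.
Qed.

End GeometricDecay.

Lemma additive_nondecreasing_linear {R : realType} (f : R -> R) :
  {morph f : x y / x + y} -> {homo f : x y / x <= y} ->
  forall x, f x = x * f 1.
Proof.
move=> fD fle; have f0 : f 0 = 0 by have := fD 0 0; rewrite addr0; lra.
have fMn x m : f (x *+ m) = f x *+ m.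
  by elim: m => [|m IHm]; rewrite ?mulr0n// !mulrS fD IHm.
have f1 : 0 <= f 1 by rewrite -f0; exact: fle.
suff pos x : 0 <= x -> f x = x * f 1.
  move=> x; have [/pos//|x0] := leP 0 x.
  have := pos (- x); rewrite oppr_ge0 (ltW x0) => /(_ isT).
  by have := fD x (- x); rewrite subrr f0; lra.
move=> x0; apply/eqP; rewrite -subr_eq0 -normr_eq0; apply/eqP.
apply/le_anti; rewrite normr_ge0 andbT leNgt; apply/negP => gap.
set e := `|_| in gap; pose N := (Num.truncn (f 1 / e)).+1.
have Ne : f 1 < N%:R * e.
  by rewrite -ltr_pdivrMr// truncnS_gt.
pose m := Num.truncn (N%:R * x).
have /andP[mle ltm] : m%:R <= N%:R * x < m.+1%:R.
  by rewrite truncn_itv// mulr_ge0.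
have fnat j : f j%:R = j%:R * f 1 by rewrite fMn mulr_natl.
have fNx : f (N%:R * x) = N%:R * f x by rewrite mulr_natl fMn mulr_natl.
have up := fle _ _ (ltW ltm); have lo := fle _ _ mle.
move: up lo; rewrite !fnat fNx -natr1 => up lo.
have mle1 := ler_wpM2r f1 mle; have ltm1 := ler_wpM2r f1 (ltW ltm).
move: Ne; rewrite ltNge => /negP; apply.
rewrite /e -[N%:R]ger0_norm// -normrM mulrBr mulrA ler_norml.
by move: mle1 ltm1; rewrite -natr1; lra.
Qed.

Lemma multiplicative_powR {R : realType} (k : R -> R) :
  (forall r, 0 < r -> 0 < k r) ->
  (forall r s, 0 < r -> 0 < s -> k (r * s) = k r * k s) ->
  (forall r, 0 < r < 1 -> k r < 1) ->
  exists2 alpha, 0 < alpha & forall r, 0 < r -> k r = r `^ alpha.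
Proof.
move=> k0 kM k1; pose f x := ln (k (expR x)).
have fD : {morph f : x y / x + y}.
  by move=> x y; rewrite /f expRD kM ?expR_gt0// lnM ?posrE ?k0 ?expR_gt0.
have f0 : f 0 = 0 by have := fD 0 0; rewrite addr0; lra.
have fneg x : x < 0 -> f x < 0.
  by move=> x0; rewrite /f ln_lt0// k0 ?expR_gt0// k1 ?expR_gt0 ?expR_lt1.
have fle : {homo f : x y / x <= y}.
  move=> x y; rewrite le_eqVlt => /predU1P[->//|xy].
  have -> : x = y + (x - y) by lra.
  by rewrite fD; have := fneg (x - y); rewrite subr_lt0 => /(_ xy); lra.
have fE := additive_nondecreasing_linear _ fD fle.
exists (f 1); first by have := fneg (-1); rewrite fE ltrN10 => /(_ isT); lra.
move=> r r0; rewrite /powR gt_eqF// [_ * ln r]mulrC -fE /f.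
by rewrite !lnK ?posrE ?k0// lnK ?posrE ?k0.
Qed.

Section InversionFormulas.
Context {R : realType} {K : division_algebra} {n : nat}.
Local Notation KK := (algebra R K).
Local Notation H := (heisenberg R K n).
Implicit Types (r s t x y : R) (z : 'rV[KK]_n.-1) (v : imaginary R K).
Implicit Types p q : H.

(* [z (x + y v)] *)
Definition comb x y z v : 'rV[KK]_n.-1 := rscale x z + rscale y (rmulv z v).

Lemma combD x y x' y' z v :
  comb x y z v + comb x' y' z v = comb (x + x') (y + y') z v.
Proof. by apply/rowP => i; rewrite !mxE !scalerDl addrACA. Qed.

Lemma rscale_comb t x y z v :
  rscale t (comb x y z v) = comb (t * x) (t * y) z v.
Proof. by rewrite /comb rscaleDr !rscaleA. Qed.

Lemma combN x y z v : - comb x y z v = comb (- x) (- y) z v.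
Proof. by rewrite -rscaleN1 rscale_comb !mulN1r. Qed.

Lemma comb10 z v : comb 1 0 z v = z.
Proof. by rewrite /comb rscale1 rscale0 addr0. Qed.

Lemma omega_comb x y x' y' z v :
  omega (comb x y z v) (comb x' y' z v) =
  (vnormsq z * (y * x' - x * y')) *: v.
Proof.
rewrite /comb !omegaDl !omegaDr !omegaZl !omegaZr !omegaxx !scaler0.
rewrite (omegaC (rmulv z v)) omega_rmulv opprK add0r addr0.
rewrite !scalerN !scalerA -scaleNr -scalerDl; congr (_ *: v); ring.
Qed.

Definition invH p : H :=
  (\row_i cdmul (p.1 0 i) (cdinv (siegel p)),
   (cdnorm (siegel p) ^+ 2)^-1 *: imconj p.2).

Lemma invHE p : invH p =
  (comb (- (vnormsq p.1 / gauge4 p)) (- (gauge4 p)^-1) p.1 p.2,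
   - ((gauge4 p)^-1 *: p.2)).
Proof.
have sgl : cdnorm (siegel p) ^+ 2 = gauge4 p.
  by rewrite cdnorm_sqr /siegel cdnormsqDim ?sqrrN//; exact: imaginaryE.
rewrite /invH imconjE sgl scalerN; congr pair.
have conj : cdconj (siegel p) =
    (- vnormsq p.1) *: cdone (doublings K) - imval p.2.
  rewrite /siegel linearD linearZ/= cdconj1; congr (_ + _).
  by rewrite [in RHS]imaginaryE opprK.
apply/rowP => i; rewrite !mxE /cdinv sgl conj.
rewrite linearZ linearB linearZ/= cdmulx1 scalerBr scalerA.
by rewrite mulrN mulrC !scaleNr.
Qed.

Lemma dilation_invH p s : s != 0 -> s ^+ 2 = gauge4 p ->
  dilation s (invH p) = (comb (- (vnormsq p.1 / s)) (- s^-1) p.1 p.2, - p.2).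
Proof.
move=> s0 sE; rewrite invHE /dilation/= rscale_comb -sE scalerN scalerA.
rewrite mulfV ?expf_neq0// scale1r; congr (comb _ _ _ _, _); by field.
Qed.

Lemma invH_horizontal z : invH (z, 0) = (rscale (- (vnormsq z)^-1) z, 0).
Proof.
rewrite invHE /gauge4/= cdnormsq0 addr0 scaler0 oppr0; congr pair.
apply/rowP => i; rewrite !mxE linear0 scaler0 addr0; congr (- _ *: _).
have [->|z0] := eqVneq (vnormsq z) 0; first by rewrite !mul0r invr0.
by rewrite expr2 invfM mulrA divff// mul1r.
Qed.

Lemma gauge4_eq0 p : (gauge4 p == 0) = (p == horigin).
Proof.
rewrite paddr_eq0 ?sqr_ge0 ?cdnormsq_ge0// expf_eq0/= vnormsq_eq0 cdnormsq_eq0.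
by case: p.
Qed.

Lemma koranyi_gauge0 : koranyi_gauge (horigin : H) = 0.
Proof.
have /eqP g0 : gauge4 (horigin : H) == 0 by rewrite gauge4_eq0.
by rewrite koranyi_gaugeE g0 powR0// invr_eq0 pnatr_eq0.
Qed.

Lemma koranyi_gauge_gt0 p : p <> horigin -> 0 < koranyi_gauge p.
Proof.
move=> p0; rewrite lt_def koranyi_gauge_ge0 andbT.
apply: contra_not_neq p0 => N0; apply/eqP.
by rewrite -gauge4_eq0 -koranyi_gaugeX4 N0 expr0n.
Qed.

Lemma koranyi_gaugeX2 p s : 0 <= s -> s ^+ 2 = gauge4 p ->
  koranyi_gauge p ^+ 2 = s.
Proof.
move=> s0 sE; apply/eqP; rewrite -(@eqrXn2 _ 2)// ?sqr_ge0//.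
by rewrite -exprM koranyi_gaugeX4 sE.
Qed.

Lemma inversionE p : p <> horigin -> inversion (Some p) = Some (invH p).
Proof. by rewrite /inversion; case: eqP. Qed.

Lemma inversion_o : inversion (Some (horigin : H)) = None.
Proof. by rewrite /inversion eqxx. Qed.

End InversionFormulas.

Lemma uniq_infty (T : eqType) (p q a : T) : p <> q -> p <> a -> q <> a ->
  uniq [:: None; Some p; Some q; Some a].
Proof.
move=> pq pa qa; rewrite /= !inE /= andbT negb_or -!andbA.
by apply/and3P; split; apply/eqP => -[].
Qed.

Lemma mulr_of_sqr (R : realDomainType) (x y w a b : R) :
  0 <= x -> 0 <= y -> 0 <= w ->
  x ^+ 2 = a -> y ^+ 2 = b -> w ^+ 2 = a * b -> x * y = w.
Proof.
move=> x0 y0 w0 xE yE wE; apply: (@pexpIrn _ 2) => //.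
  by rewrite nnegrE mulr_ge0.
by rewrite exprMn xE yE.
Qed.

(* With [w] imaginary of square norm [B], [a] and [b] are the square norms of
   [y + w / 2] and [y + 1 + w / 2], and [s] is the norm of [1 + w]. The choice
   of [y] gives [(y + w / 2) (y + 1 + w / 2) = (y + 2^-1) (1 + w)]. *)
Lemma inversion_coefficients (R : realFieldType) (B y s m a b : R) :
  0 < y -> 0 < s -> 0 < a -> 0 < b ->
  y ^+ 2 = 2^-1 + B / 4 -> a = y ^+ 2 + B / 4 -> b = (y + 1) ^+ 2 + B / 4 ->
  m = (2^-1 + y) * s -> m ^+ 2 = a * b ->
  [/\ m * (y / a - (y + 1) / b) = s^-1, m * (2^-1 / a - 2^-1 / b) = s^-1 &
    m ^+ 2 * 2 * ((2^-1 / a) * ((y + 1) / b) - (2^-1 / b) * (y / a)) = 1].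
Proof.
move=> y0 s0 a0 b0 y2 aE bE mE m2.
have y1 : 0 < 2^-1 + y by lra.
have coef : (2^-1 + y) * m / (a * b) = s^-1.
  by rewrite -m2 mE; field; rewrite !gt_eqF//; lra.
have coefz : y * b - (y + 1) * a = 2^-1 + y by rewrite aE bE; nra.
have coefJ : (b - a) / 2 = 2^-1 + y by rewrite aE bE; lra.
split.
- by rewrite -coef -coefz; field; rewrite !gt_eqF.
- by rewrite -coef -coefJ; field; rewrite !gt_eqF.
- by rewrite m2; field; rewrite !gt_eqF.
Qed.

Section SelfSimilarMetric.
Context {R : realType} {K : division_algebra} {n : nat}.
Local Notation KK := (algebra R K).
Local Notation H := (heisenberg R K n).
Local Notation o := (@horigin R K n).
Context (n_gt1 : (1 < n)%N) (d : H -> H -> R) (dm : is_metric d).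
Context (dtrans : forall a, exists2 k : R, 0 < k & scales d k (hmul a)).
Context (ddil : forall r : R, 0 < r ->
  exists2 k : R, 0 < k & scales d k (dilation r)).
Implicit Types (r s : R) (p q a : H) (z : 'rV[KK]_n.-1) (v : imaginary R K).

Let g p := d o p.

Definition basept : H := (const_mx (cdone _), 0).

Lemma basept_neq0 : basept <> o.
Proof.
move=> /(congr1 (fun p => vnormsq p.1)) /eqP; apply/negP.
rewrite /= [X in _ != X](_ : _ = 0); last first.
  by apply/eqP; rewrite vnormsq_eq0.
rewrite vnormsqE (eq_bigr (fun=> 1)); last by move=> i _; rewrite mxE cdnormsq1.
by rewrite sumr_const card_ord pnatr_eq0 -lt0n -ltnS prednK// ltnW.
Qed.

Lemma g_gt0 p : p <> o -> 0 < g p.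
Proof. by move=> p0; apply: metric_gt0 => //; exact: nesym. Qed.

Let g_basept_gt0 : 0 < g basept := g_gt0 _ basept_neq0.

(* Conjugation by [dilation 2] preserves scaling factors, so that the factor [k]
   of the translation by [a] satisfies [k ^+ j.+2 = k]. *)
Lemma translation_isometry_of_iter a j : dilation 2 a = iter j.+2 (hmul a) o ->
  forall p q, d (hmul a p) (hmul a q) = d p q.
Proof.
move=> aE; have [k k0 ka] := dtrans a.
have [|c c0 c2] := @ddil 2; first by [].
have iterM m x : hmul (iter m (hmul a) o) x = iter m (hmul a) x.
  by elim: m => [|m IHm] /=; rewrite ?hmul0p// -hmulA IHm.
have iterE x : iter j.+2 (hmul a) x = hmul (dilation 2 a) x.
  by rewrite aE iterM.
have iterd m x y : d (iter m (hmul a) x) (iter m (hmul a) y) = k ^+ m * d x y.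
  by elim: m => [|m IHm] /=; rewrite ?mul1r// ka IHm mulrA exprS.
have kk : k ^+ j.+2 = k.
  apply: (@mulIf _ (c * g basept)); first by rewrite mulf_neq0 ?gt_eqF.
  rewrite /g -[in LHS]c2 -iterd !iterE -!dilationM c2 ka; ring.
suff k1 : k = 1 by move=> p q; rewrite ka k1 mul1r.
apply/eqP; rewrite -(@pexpr_eq1 _ _ j.+1) ?ltW//; apply/eqP.
by apply: (@mulfI _ k); rewrite ?gt_eqF// -exprS kk mulr1.
Qed.

Lemma dist_translation a p q : d (hmul a p) (hmul a q) = d p q.
Proof.
have -> : a = hmul (a.1, 0) (0, a.2).
  case: a => z v; rewrite /hmul/= omega0r scaler0 !addr0 add0r//.
rewrite -!hmulA; set p' := hmul _ p; set q' := hmul _ q.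
rewrite (@translation_isometry_of_iter (a.1, 0) 0).
  apply: (@translation_isometry_of_iter (0, a.2) 2).
  rewrite /dilation/hmul/= rscaler0 !omega0l !scaler0 !addr0; congr pair.
  rewrite [2 ^+ 2](_ : _ = 1 + (1 + (1 + 1))); last by ring.
  by rewrite !scalerDl scale1r.
rewrite /dilation/hmul/= !addr0 omegaxx omega0r !scaler0 !addr0; congr pair.
by apply/rowP => i; rewrite !mxE [2](_ : _ = 1 + 1)// scalerDl scale1r.
Qed.

Lemma g_hinv p : g (hinv p) = g p.
Proof. by rewrite /g -(dist_translation p) hmulp0 hmulpV metric_symm. Qed.

Lemma dist_hmulV p q : d p q = g (hmul (hinv q) p).
Proof.
by rewrite -(dist_translation (hinv q)) hmulVp metric_symm// -g_hinv.
Qed.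

Definition kappa r := g (dilation r basept) / g basept.

Lemma kappaP r : 0 < r -> 0 < kappa r /\ scales d (kappa r) (dilation r).
Proof.
move=> r0; have [k k0 kd] := ddil r r0.
suff -> : kappa r = k by [].
by rewrite /kappa /g -[X in d X (dilation _ _)](dilation0 r) kd mulfK ?gt_eqF.
Qed.

Lemma kappa_gt0 r : 0 < r -> 0 < kappa r.
Proof. by move=> /kappaP[]. Qed.

Lemma g_dilation r p : 0 < r -> g (dilation r p) = kappa r * g p.
Proof. by move=> /kappaP[_ kd]; rewrite /g -kd dilation0. Qed.

Lemma kappaM r s : 0 < r -> 0 < s -> kappa (r * s) = kappa r * kappa s.
Proof.
by move=> r0 s0; rewrite {1}/kappa -dilation_dilation g_dilation// -mulrA.
Qed.

Lemma kappa1 : kappa 1 = 1.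
Proof.
by rewrite /kappa dilation1 divff// gt_eqF.
Qed.

Lemma kappa2_le : kappa 2 <= 2.
Proof.
rewrite /kappa ler_pdivrMr//.
have -> : dilation 2 basept = hmul basept basept.
  rewrite /dilation/hmul/= omegaxx !scaler0 !addr0; congr pair.
  by apply/rowP => i; rewrite !mxE [2](_ : _ = 1 + 1)// scalerDl scale1r.
have := metric_triang dm basept o (hmul basept basept).
by have := dist_translation basept o basept; rewrite hmulp0 /g; lra.
Qed.

Lemma kappa_lt1 r :
  (forall (u : nat -> H) p,
    tends_to (@koranyi_dist R K n) u p -> tends_to d u p) ->
  0 < r < 1 -> kappa r < 1.
Proof.
move=> top r01; have /andP[r0 _] := r01.
have N0 := koranyi_gauge_gt0 _ basept_neq0.
have kX m : kappa (r ^+ m) = kappa r ^+ m.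
  elim: m => [|m IHm]; first exact: kappa1.
  by rewrite !exprS kappaM ?exprn_gt0// IHm.
have so : tends_to (@koranyi_dist R K n) (fun m => dilation (r ^+ m) basept) o.
  move=> e e0; have eN := divr_gt0 e0 N0.
  have [N NP] := expr_lt_eventually r _ r01 eN.
  exists N => m /NP; rewrite koranyi_dist0p koranyi_gauge_dilation.
    by rewrite ltr_pdivlMr.
  by rewrite exprn_ge0 ?ltW.
have [N NP] := top _ _ so _ g_basept_gt0.
rewrite ltNge; apply/negP => k1; have := NP N (leqnn N).
rewrite -/(g _) g_dilation ?exprn_gt0// kX ltNge ler_peMl ?(ltW g_basept_gt0)//.
exact: exprn_ege1.
Qed.

Section Inversion.
Context (dinv : forall p1 p2 p3 p4 : option H, uniq [:: p1; p2; p3; p4] ->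
  cross_ratio d (inversion p1) (inversion p2) (inversion p3) (inversion p4) =
  cross_ratio d p1 p2 p3 p4).

Lemma g_invH_ratio p q : p <> o -> q <> o -> p <> q ->
  g (invH p) / g (invH q) = g q / g p.
Proof.
move=> p0 q0 pq.
have := dinv _ _ _ _ (uniq_infty _ _ _ _ (nesym p0) (nesym q0) pq).
rewrite inversion_o !inversionE// /cross_ratio /cross_factor/=.
by rewrite !divr1 !div1r ?mul1r mulrC !(metric_symm dm _ o).
Qed.

Lemma d_invH_ratio p q : p <> o -> q <> o -> p <> q ->
  g (invH p) / d (invH p) (invH q) = g q / d p q.
Proof.
move=> p0 q0 pq.
have := dinv _ _ _ _ (uniq_infty _ _ _ _ (nesym pq) q0 p0).
rewrite inversion_o !inversionE// /cross_ratio /cross_factor/=.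
by rewrite !divr1 !div1r ?mul1r !(metric_symm dm _ o).
Qed.

Definition inv_const := g basept * g (invH basept).

Lemma g_neq0 p : p <> o -> g p != 0.
Proof. by move=> p0; rewrite gt_eqF ?g_gt0. Qed.

Lemma g_invH_neq0 p q : p <> o -> q <> o -> p <> q -> g (invH p) != 0.
Proof.
move=> p0 q0 pq; have /eqP := g_invH_ratio _ _ p0 q0 pq.
apply: contraTneq => ->; rewrite mul0r eq_sym.
by rewrite mulf_neq0 ?invr_eq0 ?g_neq0.
Qed.

Lemma dilation2_basept_neq : dilation 2 basept <> basept.
Proof.
move=> /(congr1 (@koranyi_gauge R K n)); rewrite koranyi_gauge_dilation//.
by have := koranyi_gauge_gt0 _ basept_neq0; lra.
Qed.

Lemma dilation2_basept_neq0 : dilation 2 basept <> o.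
Proof.
move=> bE; have := mulr_gt0 (kappa_gt0 _ (ltr0Sn R 1)) g_basept_gt0.
by rewrite -g_dilation// bE /g (metric_xx dm) ltxx.
Qed.

Lemma inv_const_gt0 : 0 < inv_const.
Proof.
rewrite mulr_gt0// lt_def (metric_ge0 _ dm) andbT.
by apply: (g_invH_neq0 _ (dilation 2 basept)) => //;
  [exact: basept_neq0|exact: dilation2_basept_neq0|];
  exact/nesym/dilation2_basept_neq.
Qed.

Lemma g_invH p : p <> o -> g (invH p) = inv_const / g p.
Proof.
move=> p0; have [->|/eqP pb] := eqVneq p basept; rewrite /inv_const.
  by rewrite mulrC mulKf// gt_eqF.
have Ib : g (invH basept) != 0.
  by apply: (g_invH_neq0 _ p) => //; [exact: basept_neq0|exact: nesym].
have := g_invH_ratio _ _ p0 basept_neq0 pb.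
move=> /(congr1 ( *%R^~ (g (invH basept)))); rewrite divfK// => ->.
by rewrite mulrAC.
Qed.

Lemma d_invH p q : p <> o -> q <> o -> p <> q ->
  d (invH p) (invH q) = inv_const * d p q / (g p * g q).
Proof.
move=> p0 q0 pq; have := d_invH_ratio _ _ p0 q0 pq.
rewrite g_invH//.
have gp := g_neq0 _ p0; have gq := g_neq0 _ q0.
have dpq : d p q != 0 by rewrite gt_eqF// metric_gt0.
have c0 : inv_const != 0 by rewrite gt_eqF// inv_const_gt0.
set D := d (invH p) _ => E.
have D0 : D != 0.
  apply: contra_eq_neq E => ->; rewrite invr0 mulr0 eq_sym.
  by rewrite mulf_neq0 ?invr_eq0.
have -> : D = (inv_const / g p) / (inv_const / g p / D).
  by field; rewrite ?D0 ?gp ?c0.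
by rewrite E; field; rewrite ?gp ?gq.
Qed.

(* [koranyi_gauge p ^+ 2] is the dilation that brings [invH p] back to the
   gauge of [p]. *)
Lemma g_self_inverse p : p <> o ->
  g (dilation (koranyi_gauge p ^+ 2) (invH p)) = g p ->
  g p = Num.sqrt inv_const * kappa (koranyi_gauge p).
Proof.
move=> p0 pE; have N0 := koranyi_gauge_gt0 _ p0; have gp := g_gt0 _ p0.
have k0 := kappa_gt0 _ N0.
move: pE; rewrite g_dilation ?exprn_gt0// expr2 kappaM// g_invH// => pE.
have : g p ^+ 2 = inv_const * kappa (koranyi_gauge p) ^+ 2.
  by rewrite expr2 -{1}pE; field; rewrite gt_eqF.
move=> /(congr1 Num.sqrt); rewrite sqrtr_sqr sqrtrM ?(ltW inv_const_gt0)//.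
by rewrite sqrtr_sqr !gtr0_norm.
Qed.

Lemma g_horizontal z : z != 0 ->
  g (z, 0) = Num.sqrt inv_const * kappa (koranyi_gauge (z, 0)).
Proof.
move=> z0; apply: g_self_inverse; first exact: neq_origin1.
have A0 : 0 < vnormsq z by rewrite lt_def vnormsq_ge0 vnormsq_eq0 z0.
rewrite (@koranyi_gaugeX2 _ _ _ _ (vnormsq z)) ?ltW//; last first.
  by rewrite /gauge4/= cdnormsq0 addr0.
rewrite invH_horizontal /dilation/= rscaleA scaler0 mulrN mulfV ?gt_eqF//.
by rewrite rscaleN1 -[RHS]g_hinv /hinv/= oppr0.
Qed.

Lemma g_vertical v : v != 0 ->
  g (0, v) = Num.sqrt inv_const * kappa (koranyi_gauge ((0, v) : H)).
Proof.
move=> v0; apply: g_self_inverse; first exact: neq_origin2.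
rewrite dilation_invH -?exprM ?koranyi_gaugeX4//; last first.
  rewrite expf_neq0// gt_eqF// koranyi_gauge_gt0//.
  exact: neq_origin2.
rewrite -[RHS]g_hinv /hinv/= oppr0; congr (g (_, _)).
by apply/rowP => i; rewrite !mxE cdmul0x !scaler0 addr0.
Qed.

(* The points [p] and [q] are horizontal, [hmul (hinv q) p = (z, v)], and
   [hmul (hinv (invH q)) (invH p)] is, up to dilation, the inverse of
   [invH (z, v)]: this is what computes [g (invH (z, v)) / g (z, v)]. *)
Lemma g_unit z v : vnormsq z = 1 ->
  g (z, v) = Num.sqrt inv_const * kappa (koranyi_gauge (z, v)).
Proof.
move=> z1; set B := cdnormsq (imval v).
have B0 : 0 <= B by exact: cdnormsq_ge0.
pose y : R := Num.sqrt (2^-1 + B / 4).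
have y2 : y ^+ 2 = 2^-1 + B / 4 by rewrite sqr_sqrtr//; lra.
have y0 : 0 < y by rewrite sqrtr_gt0; lra.
pose s : R := Num.sqrt (1 + B).
have s2 : s ^+ 2 = 1 + B by rewrite sqr_sqrtr//; lra.
have s0 : 0 < s by rewrite sqrtr_gt0; lra.
pose m : R := (2^-1 + y) * s.
have m0 : 0 < m by rewrite mulr_gt0//; lra.
pose a : R := y ^+ 2 + B / 4; pose b : R := (y + 1) ^+ 2 + B / 4.
have a_gt0 : 0 < a by rewrite /a y2; lra.
have b_gt0 : 0 < b by rewrite /b; nra.
have aE : a = y ^+ 2 + B / 4 by [].
have bE : b = (y + 1) ^+ 2 + B / 4 by [].
have mE : m = (2^-1 + y) * s by [].
have m2 : m ^+ 2 = a * b by rewrite mE exprMn s2 aE bE; nra.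
clearbody m s y a b.
pose p : H := (comb (- y) (- 2^-1) z v, 0).
pose q : H := (comb (- (y + 1)) (- 2^-1) z v, 0).
have pa : vnormsq p.1 = a by rewrite vnormsq_rmulv z1 aE -/B; field.
have qb : vnormsq q.1 = b by rewrite vnormsq_rmulv z1 bE -/B; field.
have p0 : p.1 != 0 by rewrite -vnormsq_eq0 pa gt_eqF.
have q0 : q.1 != 0 by rewrite -vnormsq_eq0 qb gt_eqF.
have po : p <> o by exact: neq_origin1.
have qo : q <> o by exact: neq_origin1.
have pq : p <> q.
  by move=> pE; move: pa; rewrite pE qb aE bE; nra.
have zvE : hmul (hinv q) p = (z, v).
  rewrite /hmul/= combN combD omega_comb z1; congr pair.
    by rewrite -[RHS](comb10 z v); congr comb; field.
  by rewrite oppr0 !add0r scalerA -[RHS]scale1r; congr (_ *: _); field.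
have Np : koranyi_gauge p ^+ 2 = a.
  by apply: koranyi_gaugeX2; rewrite ?ltW// /gauge4 pa cdnormsq0 addr0.
have Nq : koranyi_gauge q ^+ 2 = b.
  by apply: koranyi_gaugeX2; rewrite ?ltW// /gauge4 qb cdnormsq0 addr0.
have Npq : koranyi_gauge p * koranyi_gauge q = m.
  apply: mulr_of_sqr Np Nq m2; rewrite ?koranyi_gauge_ge0//.
  exact: ltW.
have gpq : g p * g q = inv_const * kappa m.
  rewrite !g_horizontal// mulrACA -expr2 sqr_sqrtr ?(ltW inv_const_gt0)//.
  by rewrite -kappaM ?koranyi_gauge_gt0// Npq.
have zvs : s ^+ 2 = gauge4 (z, v) by rewrite /gauge4/= z1 expr1n.
have z0 : z != 0 by rewrite -vnormsq_eq0 z1 oner_eq0.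
apply: g_self_inverse; first exact: neq_origin1.
rewrite (koranyi_gaugeX2 _ _ (ltW s0) zvs) dilation_invH ?gt_eqF//.
rewrite z1 -[LHS]g_hinv.
transitivity (g (dilation m (hmul (hinv (invH q)) (invH p)))).
  congr g; rewrite !invH_horizontal pa qb /hmul/hinv/dilation/= opprK.
  rewrite !rscale_comb !combN combD rscale_comb omega_comb z1.
  rewrite oppr0 !add0r !scalerA.
  have [c1 cJ cv] :=
    inversion_coefficients R B y s m a b y0 s0 a_gt0 b_gt0 y2 aE bE mE m2.
  congr (comb _ _ _ _, _).
  - by rewrite opprK div1r -c1; ring.
  - by rewrite opprK -cJ; ring.
  - rewrite -[LHS]scale1r; congr (_ *: v); rewrite -[LHS]cv; ring.
rewrite g_dilation// -dist_hmulV d_invH// gpq -zvE -dist_hmulV; field.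
by rewrite !gt_eqF ?inv_const_gt0 ?kappa_gt0.
Qed.

Lemma g_gauge p : p <> o -> g p = Num.sqrt inv_const * kappa (koranyi_gauge p).
Proof.
case: p => z v p0; have [zE|z0] := eqVneq z 0.
  by rewrite zE g_vertical//; apply: contra_not_neq p0 => ->; rewrite zE.
have A0 : 0 < vnormsq z by rewrite lt_def vnormsq_ge0 vnormsq_eq0 z0.
set t := Num.sqrt (vnormsq z); have t0 : 0 < t by rewrite sqrtr_gt0.
pose p' : H := dilation t^-1 (z, v).
have -> : (z, v) = dilation t p'.
  by rewrite dilation_dilation mulfV ?gt_eqF// dilation1.
rewrite g_dilation// koranyi_gauge_dilation ?(ltW t0)//.
have z'1 : vnormsq p'.1 = 1.
  by rewrite vnormsqZ exprVn sqr_sqrtr ?ltW// mulVf// gt_eqF.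
have p'0 : p' <> o.
  by apply: neq_origin1; rewrite -vnormsq_eq0 z'1 oner_eq0.
rewrite kappaM ?koranyi_gauge_gt0// (g_unit _ _ z'1).
by rewrite mulrCA.
Qed.

End Inversion.
End SelfSimilarMetric.

Theorem theorem1p2 (R : realType) (K : division_algebra) (n : nat)
  (hn : (2 <= n)%N) (hO : K = Octonions -> n = 2%N) (hR : K <> Reals)
  (d : heisenberg R K n -> heisenberg R K n -> R) (hd : is_metric d)
  (hSim : similarity horigin (@koranyi_dist R K n) `<=` similarity horigin d)
  (hTop : forall p : nat -> option (heisenberg R K n),
    converges horigin (@koranyi_dist R K n) p -> converges horigin d p)
  (hInv : mobius horigin d (@inversion R K n)) :
  exists2 beta : R, 0 < beta &
  exists2 alpha : R, 0 < alpha <= 1 &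
    forall p q : heisenberg R K n,
      d p q = beta * koranyi_dist p q `^ alpha.
Proof.
have dtrans a : exists2 k : R, 0 < k & scales d k (hmul a).
  by apply: similarity_scales; apply: hSim; exact: translation_similarity.
have ddil r : 0 < r -> exists2 k : R, 0 < k & scales d k (dilation r).
  move=> r0; apply: similarity_scales; apply: hSim.
  exact: dilation_similarity.
have dtop u p : tends_to (@koranyi_dist R K n) u p -> tends_to d u p.
  apply: tends_to_transfer hd hTop _.
  by rewrite -(koranyi_distM (hinv p)) hmulVp koranyi_dist0p koranyi_gauge0.
have [_ dinv] := hInv.
have [|||alpha alpha0 kappaE] := multiplicative_powR (kappa d).
- by move=> r; exact: kappa_gt0.
- by move=> r s; exact: kappaM.
- by move=> r; exact: kappa_lt1.
exists (Num.sqrt (inv_const d)).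
  by rewrite sqrtr_gt0; exact: inv_const_gt0.
exists alpha.
  rewrite alpha0 leNgt; apply/negP => alpha1.
  have := kappa2_le hn d hd dtrans ddil; rewrite kappaE// leNgt => /negP; apply.
  rewrite /powR pnatr_eq0/= -[ltLHS]lnK ?posrE// ltr_expR ltr_pMl//.
  by rewrite ln_gt0// ltr1n.
move=> p q; rewrite (dist_hmulV hn d hd dtrans ddil) /koranyi_dist.
have [->|/eqP pq0] := eqVneq (hmul (hinv q) p) horigin.
  by rewrite (metric_xx hd) koranyi_gauge0 powR0 ?mulr0// gt_eqF.
rewrite (g_gauge hn d hd dtrans ddil dinv _ pq0) kappaE//.
exact: koranyi_gauge_gt0.
Qed.
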